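(* For all positive integers $n,r$, \[\sum_{k=0}^r\mathcal{C}_k(q)\sum_{m=0}^{r-k}(1-q)^m\binom{n-2k-m}{r-k-m}\binom{k+m}{m}=\binom{n+1}{r}.\]
   Context: $q$ is an indeterminate. The Narayana polynomials are $C_0(q)=1$ and $C_n(q)=\sum_{k=1}^n \frac1n\binom{n}{k-1}\binom{n}{k}q^{k-1}$ for $n\ge1$; the large Narayana polynomials are $\mathcal{C}_0(q)=1$ and $\mathcal{C}_n(q)=q\,C_n(q)$ for $n\ge1$. Binomial coefficients $\binom{x}{k}$ with integer $k\ge0$ and arbitrary (possibly negative) integer $x$ mean $x(x-1)\cdots(x-k+1)/k!$. *)

(* Defs.v *)
From mathcomp Require Import all_boot all_order all_algebra.

Set Implicit Arguments.
Unset Strict Implicit.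
Unset Printing Implicit Defensive.

Import GRing.Theory Num.Theory.
Local Open Scope ring_scope.

(* x (x - 1) ... (x - k + 1) / k!, for an arbitrary, possibly negative,
   integer x. *)
Definition binz (x : int) (k : nat) : rat :=
  (\prod_(i < k) (x - i%:Z)%:~R) / (k`!)%:R.

(* The indeterminate q is the variable 'X of {poly rat}. *)
Definition narayana (n : nat) : {poly rat} :=
  if n == 0%N then 1
  else \sum_(1 <= k < n.+1)
         (n%:R^-1 * 'C(n, k.-1)%:R * 'C(n, k)%:R) *: 'X^(k.-1).

Definition large_narayana (n : nat) : {poly rat} :=
  if n == 0%N then 1 else 'X * narayana n.

(* On natural numbers, binz is the library's binomial coefficient. *)
Lemma binz_nat (n k : nat) : binz n%:Z k = 'C(n, k)%:R.
Proof.
have k0 : k`!%:R != 0 :> rat by rewrite pnatr_eq0 -lt0n fact_gt0.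
apply: (canLR (mulfK k0)); rewrite -natrM bin_ffact.
elim: k {k0} => [|k IHk]; first by rewrite big_ord0 ffactn0.
rewrite big_ord_recr /= IHk ffactnSr natrM.
case: (leqP k n) => [le_kn | lt_nk]; last by rewrite ffact_small // !mul0r.
by rewrite subzn // -pmulrn.
Qed.

(* Main.v *)
(** Write [phi := (1 + z)(1 + qz)], and let [c_k = q C_k(q)] be the large Narayana
    polynomials.  As [k C_k(q)] is the coefficient of [z^(k-1)] in [phi^k], Lagrange
    inversion says that the series [sum_k c_k x^k] takes the value [1 + qz] at
    [x = z / phi].  The inner sum of the theorem is the coefficient of [z^(r-k)] in
    [W_k = (1 + z)^(n+1) / (1 + qz) / phi^k], so that the left-hand side is the
    coefficient of [z^r] in [(1 + z)^(n+1)].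

    Polynomials suffice, with [W_k] truncated at order [r + 1]: since
    [phi W_(k+1) = W_k], the sum of the [c_k z^k W_k] is [W_r] times that of the
    [c_k z^k phi^(r-k)]. *)

Require Import Defs.
From mathcomp Require Import all_boot all_order all_algebra.
From mathcomp Require Import ring.

Import GRing.Theory Num.Theory.
Local Open Scope ring_scope.

Definition eqmodX {R : nzRingType} (N : nat) (p q : {poly R}) :=
  forall i, (i < N)%N -> p`_i = q`_i.

Lemma eqmodX_trans {R : nzRingType} {N} {p} q {s : {poly R}} :
  eqmodX N p q -> eqmodX N q s -> eqmodX N p s.
Proof. by move=> epq eqs i iN; rewrite epq ?eqs. Qed.

Lemma eqmodX_mull {R : nzRingType} {N} (s : {poly R}) {p q} :
  eqmodX N p q -> eqmodX N (s * p) (s * q).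
Proof.
move=> epq i iN; rewrite !coefM; apply: eq_bigr => j _.
by rewrite epq // (leq_ltn_trans (leq_subr _ _) iN).
Qed.

Lemma eqmodX_sum {R : nzRingType} {N n} {F G : nat -> {poly R}} :
  (forall k, (k < n)%N -> eqmodX N (F k) (G k)) ->
  eqmodX N (\sum_(0 <= k < n) F k) (\sum_(0 <= k < n) G k).
Proof.
move=> eFG i iN; rewrite !coef_sum !big_mkord.
by apply: eq_bigr => k _; apply: eFG.
Qed.

(** Turns a first-order recurrence into a product of generating functions. Truncation is harmless,
    as coefficient [i] of the product involves only [f i] and [f (i - 1)]. *)
Lemma eqmodX_mul_linear {R : comNzRingType} {N} {c : R} {f} (g : nat -> R) :
  f 0%N = g 0%N -> (forall s, f s.+1 + c * f s = g s.+1) ->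
  eqmodX N ((1 + c%:P * 'X) * \poly_(s < N) f s) (\poly_(s < N) g s).
Proof.
move=> fg0 fgS i iN; rewrite mulrDl mul1r -mulrA coefD coefCM coefXM !coef_poly.
case: i iN => [|i] iN; rewrite iN /= ?mulr0 ?addr0 //.
by rewrite (ltnW iN) fgS.
Qed.

Section Lagrange.

Variables (R : idomainType) (phi : {poly R}).
Hypothesis charR : [pchar R] =i pred0.

(** The operator [z d/dz] multiplies the coefficient of [z^j] by [j] and sends [phi^(n+1)] to
    [(n+1) z phi^n phi']. *)
Lemma coef_exp_sub_deriv n j :
  n.+1%:R * (phi ^+ n * (phi - 'X * phi^`()))`_j
    = (n.+1%:R - j%:R) * (phi ^+ n.+1)`_j.
Proof.
have dE : n.+1%:R * ('X * (phi ^+ n * phi^`()))`_j = j%:R * (phi ^+ n.+1)`_j.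
  rewrite mulr_natl -coefMn -mulrnAr -[_ *+ n.+1](_ : (phi ^+ n.+1)^`() = _).
    by rewrite coefXM; case: j => [|j]; rewrite ?mul0r //= coef_deriv mulr_natl.
  by rewrite deriv_exp mulrC.
by rewrite mulrBr -exprSr mulrCA coefB mulrBr dE mulrBl.
Qed.

Variable L : nat -> R.
Hypothesis L_coef : forall k, k.+1%:R * L k.+1 = (phi ^+ k.+1)`_k.
Hypothesis phi0 : phi`_0 = 1.

(** This is [z = sum_k L_k (z / phi)^k], cleared of denominators by [phi^M]; the terms with [k > M]
    have order above [M]. *)
Lemma lagrange_inversion M :
  eqmodX M.+1 (\sum_(0 <= k < M) L k.+1 *: ('X^(k.+1) * phi ^+ (M - k.+1)))
              ('X * phi ^+ M).
Proof.
pose D M := 'X * phi ^+ M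
  - \sum_(0 <= k < M) L k.+1 *: ('X^(k.+1) * phi ^+ (M - k.+1)).
suff D0 : forall i, (i < M.+1)%N -> (D M)`_i = 0.
  by move=> i iM; apply/esym/eqP; rewrite -subr_eq0 -coefB D0.
have natI n (x y : R) : n.+1%:R * x = n.+1%:R * y -> x = y.
  by apply: mulfI; rewrite ((pcharf0P R).1 charR).
elim: M => [|M IHM] i iM.
  by rewrite /D big_geq // subr0 mulr1 coefX; case: i iM.
have DS : D M.+1 = phi * D M - L M.+1 *: 'X^(M.+1).
  rewrite /D big_nat_recr //= subnn mulr1 opprD addrA mulrBr exprS mulrCA.
  congr (_ - _ - _); rewrite mulr_sumr; apply: eq_big_nat => k /andP[_ kM].
  by rewrite -scalerAr mulrCA -exprS subSn.
have low_coefM (p : {poly R}) : (p * D M)`_M.+1 = p`_0 * (D M)`_M.+1.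
  rewrite coefM big_ord_recl subn0 big1 ?addr0 // => j _.
  by rewrite IHM ?mulr0 // lift0 subSS ltnS leq_subr.
rewrite DS coefB coefZ coefXn.
(* Below order [M + 1] the induction hypothesis suffices; the value of [L M.+1] matters only for the
   coefficient of index [M + 1]. *)
move: iM; rewrite ltnS leq_eqVlt => /predU1P[->|iM]; last first.
  rewrite ltn_eqF // mulr0 subr0 coefM big1 // => j _.
  by rewrite IHM ?mulr0 // (leq_ltn_trans (leq_subr _ _)).
rewrite eqxx mulr1 low_coefM phi0 mul1r; apply/eqP; rewrite subr_eq0; apply/eqP.
(* As [D M] starts at order [M + 1], its coefficient there does not change when
   multiplied by [phi - z phi'], which kills all the terms [L k] of [D M]. *)
have -> : (D M)`_M.+1 = ((phi - 'X * phi^`()) * D M)`_M.+1.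
  by rewrite low_coefM (coefB phi) coefXM subr0 phi0 mul1r.
rewrite /D mulrBr mulrCA coefB coefXM /= mulr_sumr coef_sum.
(* Term [k] gives the coefficient of index [M - k] in [phi^(M-k-1) (phi - z phi')], where the factor
   [n + 1 - j] of [coef_exp_sub_deriv] is 0. *)
rewrite big1_seq ?subr0 => [|k]; last first.
  rewrite mem_index_iota => /andP[_ kM].
  rewrite -scalerAr mulrCA coefZ coefXnM ltnNge (leq_trans kM) //=.
  rewrite subSS [_ * phi ^+ _]mulrC; apply/eqP; rewrite mulf_eq0; apply/orP; right.
  apply/eqP/(natI (M - k.+1)%N).
  by rewrite coef_exp_sub_deriv subnSK // subrr mul0r mulr0.
(* For the remaining term [z phi^M] that factor is 1. *)
apply: (natI M); rewrite [_ * phi ^+ _]mulrC coef_exp_sub_deriv L_coef.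
by rewrite -natrB // subSnn mul1r.
Qed.

End Lagrange.

Lemma binz0 a : binz a 0 = 1.
Proof. by rewrite /binz big_ord0 divr1. Qed.

(** The numerators share [a (a-1) ... (a-k+1)], and the extra factors satisfy
    [(a + 1) - (a - k) = k + 1]. *)
Lemma binzS a k : binz (a + 1) k.+1 = binz a k.+1 + binz a k.
Proof.
rewrite /binz big_ord_recl [X in _ = X / _ + _]big_ord_recr /=.
have shift (i : 'I_k) : a + 1 - (lift ord0 i)%:Z = a - i%:Z.
  by rewrite lift0 -addn1 PoszD; ring.
under eq_bigr => i _ do rewrite shift.
rewrite factS natrM !rmorphB rmorphD /= -natr1.
have k0 : k`!%:R != 0 :> rat by rewrite pnatr_eq0 -lt0n fact_gt0.
have k1 : k%:R + 1 != 0 :> rat by rewrite natr1 pnatr_eq0.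
by field; rewrite k0 k1.
Qed.

Local Notation q := ('X : {poly rat}).
Local Notation phi := ((1 + 1%:P * 'X) * (1 + q%:P * 'X) : {poly {poly rat}}).

(* The coefficient of [z^s] in [(1 + z)^(a + k) / (1 + qz)^k]. *)
Definition inner_sum (k : nat) (a : int) (s : nat) : {poly rat} :=
  \sum_(0 <= m < s.+1)
    (1 - q) ^+ m * (binz (a - m%:Z) (s - m))%:P * 'C((k + m).-1, m)%:R.

Lemma inner_sum0r k a : inner_sum k a 0 = 1.
Proof. by rewrite /inner_sum big_nat1 binz0 bin0 !mulr1. Qed.

(** Only [m = 0] survives: ['C(m.-1, m)] is 0 for [m > 0], but 1 at [m = 0] since [0.-1 = 0]. *)
Lemma inner_sum0l a s : inner_sum 0 a s = (binz a s)%:P.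
Proof.
rewrite /inner_sum big_nat_recl //= big1 => [|m _].
  by rewrite addr0 subn0 subr0 mul1r mulr1.
by rewrite bin_small // mulr0.
Qed.

(** Multiplication by [1 + z]: Pascal's rule in the factor [binz]. *)
Lemma inner_sum_binzS k a s :
  inner_sum k a s.+1 + 1 * inner_sum k a s = inner_sum k (a + 1) s.+1.
Proof.
rewrite /inner_sum mul1r !(big_nat_recr s.+1) //= subnn !binz0 addrAC -big_split /=.
congr (_ + _); apply: eq_big_nat => m /andP[_ ms].
by rewrite subSn // addrAC binzS polyCD mulrDr mulrDl.
Qed.

(** Multiplication by [1 + qz = (1 + z) - (1 - q) z]: the first part raises [a], the second shifts
    [m], and Pascal's rule in ['C(k + m, m)] then lowers [k]. *)
Lemma inner_sum_recl k a s :
  inner_sum k.+1 a s.+1 + q * inner_sum k.+1 a s = inner_sum k (a + 1) s.+1.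
Proof.
rewrite (_ : q = 1 - (1 - q)); last by rewrite subKr.
rewrite mulrBl addrA inner_sum_binzS /inner_sum mulr_sumr.
rewrite [X in X - _]big_nat_recl // [RHS]big_nat_recl // !bin0 -addrA.
congr (_ + _); rewrite -sumrB; apply: eq_bigr => m _.
rewrite addnS addSn /= subSS addnS /= binS natrD exprS.
rewrite (_ : a + 1 - m.+1%:Z = a - m%:Z); last by rewrite -addn1 PoszD; ring.
by ring.
Qed.

Lemma coef_exp_linear {R : comNzRingType} (c : R) n i :
  ((1 + c%:P * 'X) ^+ n)`_i = 'C(n, i)%:R * c ^+ i.
Proof.
elim: n i => [|n IHn] i.
  by rewrite expr0 coef1 bin0n; case: i => [|i]; rewrite ?mul1r ?mul0r.
rewrite exprS mulrDl mul1r -mulrA coefD coefCM coefXM !IHn.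
case: i => [|i] /=; first by rewrite !bin0 mulr0 addr0.
by rewrite binS natrD exprS; ring.
Qed.

(** Convolution of the binomial expansions of [(1 + z)^(k+1)] and [(1 + qz)^(k+1)]. *)
Lemma coef_phi_exp k : k.+1%:R * narayana k.+1 = (phi ^+ k.+1)`_k.
Proof.
rewrite exprMn coefMr /narayana /= big_add1 /= big_mkord mulr_sumr.
apply: eq_bigr => j _; rewrite !coef_exp_linear expr1n mulr1.
have -> : 'C(k.+1, k - j) = 'C(k.+1, j.+1) by rewrite -subSS bin_sub.
have k0 : k.+1%:R * (k.+1%:R^-1)%:P = 1 :> {poly rat}.
  by rewrite -polyC_natr -polyCM divff // pnatr_eq0.
by rewrite -mul_polyC !polyCM !polyC_natr !mulrA k0 mul1r [_ * 'C(_, j)%:R]mulrC.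
Qed.

(** Lagrange inversion times [q] gives the terms [k > 0]; the term [k = 0] supplies the 1 of
    [1 + qz]. *)
Lemma large_narayana_lagrange r :
  eqmodX r.+1 (\sum_(0 <= k < r.+1) (large_narayana k)%:P * ('X^k * phi ^+ (r - k)))
              ((1 + q%:P * 'X) * phi ^+ r).
Proof.
have charP : [pchar {poly rat}] =i pred0.
  by move=> p; rewrite pchar_poly; apply: pchar_num.
have phi0 : phi`_0 = 1.
  by rewrite -[phi]expr1 exprMn coef0M !coef_exp_linear bin0 !mul1r.
have lag := @lagrange_inversion _ phi charP narayana coef_phi_exp phi0 r.
have /= lagq := eqmodX_mull q%:P lag.
rewrite [(1 + q%:P * 'X) * _]mulrDl mul1r -[q%:P * 'X * _]mulrA => i ir.
rewrite [RHS]coefD -lagq // -coefD big_nat_recl // subn0 !mul1r mulr_sumr.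
congr (polyseq (_ + _))`_i.
apply: eq_bigr => k _; rewrite /large_narayana /= polyCM -mulrA.
by rewrite [(narayana _)%:P * _]mul_polyC.
Qed.

Theorem theorem5 (n r : nat) (hn : (0 < n)%N) (hr : (0 < r)%N) :
  \sum_(0 <= k < r.+1) large_narayana k *
    (\sum_(0 <= m < (r - k).+1)
       (1 - 'X) ^+ m
       * (binz (n%:Z - (2 * k)%:Z - m%:Z) (r - k - m))%:P
       * 'C(k + m, m)%:R)
  = 'C(n + 1, r)%:R :> {poly rat}.
Proof.
(* The exponents match: [(1 + z)^(n+1) / (1 + qz) / phi^k = (1 + z)^((n-2k) + (k+1)) / (1 +
   qz)^(k+1)]. *)
pose W k : {poly {poly rat}} :=
  \poly_(s < r.+1) inner_sum k.+1 (n%:Z - (2 * k)%:Z) s.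
have WS k : eqmodX r.+1 (phi * W k.+1) (W k).
  (* The factor [1 + qz] lowers the index [k + 2] to [k + 1] and raises [n - 2k - 2] by one; the
     factor [1 + z] raises it once more. *)
  rewrite -mulrA; apply: eqmodX_trans.
    apply/eqmodX_mull/eqmodX_mul_linear; last by move=> s; apply: inner_sum_recl.
    by rewrite !inner_sum0r.
  apply: eqmodX_mul_linear; first by rewrite !inner_sum0r.
  move=> s; rewrite inner_sum_binzS; congr inner_sum.
  by rewrite mulnS PoszD; ring.
have WE k : (k <= r)%N -> eqmodX r.+1 (W k) (phi ^+ (r - k) * W r).
  move=> kr; rewrite -{1}(subKn kr).
  elim: (r - k)%N (leq_subr k r) => [|d IHd] dr; first by rewrite subn0 mul1r.
  have /(eqmodX_mull phi) := IHd (ltnW dr).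
  rewrite mulrA -exprS; apply: eqmodX_trans => i ir.
  by rewrite -(subnSK dr) WS.
transitivity ((\sum_(0 <= k < r.+1) (large_narayana k)%:P * ('X^k * W k))`_r).
  rewrite coef_sum; apply: eq_big_nat => k /andP[_ kr].
  by rewrite coefCM coefXnM ltnNge -ltnS kr /= coef_poly ltnS leq_subr.
transitivity ((W r * \sum_(0 <= k < r.+1)
    (large_narayana k)%:P * ('X^k * phi ^+ (r - k)))`_r).
  rewrite mulr_sumr; apply: eqmodX_sum (ltnSn r) => k kr.
  rewrite [W r * _]mulrCA [W r * _]mulrCA [W r * _]mulrC.
  by apply/eqmodX_mull/eqmodX_mull/WE.
rewrite (eqmodX_mull _ (large_narayana_lagrange r)) //.
(* Here [phi^r W_r] collapses to [W_0], and the leftover [1 + qz] cancels its denominator. *)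
rewrite mulrC -mulrA -{1}[r]subn0 -(eqmodX_mull _ (WE 0%N _)) //.
rewrite (eqmodX_mul_linear (inner_sum 0 n.+1%:Z)) ?inner_sum0r //.
  by rewrite coef_poly ltnSn inner_sum0l binz_nat addn1 polyC_natr.
by move=> s; rewrite inner_sum_recl muln0 subr0 -[n.+1]addn1 PoszD.
Qed.
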